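(* Let $m\ge 4$ and let $1<c_2<c_3<\cdots<c_m$ be natural numbers. If the coin system $\langle 1,c_2,c_3\rangle$ is non-canonical, then the coin system $\$_2=\langle 1,c_2,c_3,\dots,c_m\rangle$ is non-canonical and there exists a counterexample $x$ of $\$_2$ with $x<c_m+c_3$.
   Context: A coin system is a tuple $\$=\langle c_1,\dots,c_m\rangle$ of natural numbers with $1=c_1<c_2<\cdots<c_m$. A representation of $x$ is a tuple $(\alpha_1,\dots,\alpha_m)$ of natural numbers with $\sum_i\alpha_ic_i=x$, of size $\sum_i\alpha_i$. The greedy representation $\mathrm{GRD}_{\$}(x)$ is the representation with $\sum_{j<i}\alpha_jc_j<c_i$ for all $2\le i\le m$; $\mathrm{OPT}_{\$}(x)$ is a representation of minimum size. The system is canonical if $|\mathrm{GRD}_{\$}(x)|=|\mathrm{OPT}_{\$}(x)|$ for all $x$, and non-canonical otherwise; a counterexample of $\$$ is a natural number $x$ with $|\mathrm{GRD}_{\$}(x)|>|\mathrm{OPT}_{\$}(x)|$. *)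

(* Defs.v *)
(* Tuples are indexed from 0: the i-th coin c_i is [nth 0 c i.-1]. *)
From mathcomp Require Import all_boot.

Set Implicit Arguments.
Unset Strict Implicit.
Unset Printing Implicit Defensive.

(* The first condition forces 0 < m, since the default value is 0. *)
Definition coin_system (m : nat) (c : m.-tuple nat) : Prop :=
  nth 0 c 0 = 1 /\ sorted ltn c.

Definition representation (m : nat) (c : m.-tuple nat) (x : nat)
    (a : m.-tuple nat) : Prop :=
  \sum_(i < m) tnth a i * tnth c i = x.

Definition rep_size (m : nat) (a : m.-tuple nat) : nat :=
  \sum_(i < m) tnth a i.

(* GRD and OPT are rendered as relations.  For coin systems, the first is
   functional and total ([greedy_unique], [greedy_exists]); the second is total
   ([optimal_exists]) and determines the size ([optimal_size_unique]). *)
Definition greedy (m : nat) (c : m.-tuple nat) (x : nat)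
    (a : m.-tuple nat) : Prop :=
  representation c x a /\
  forall i : 'I_m, 0 < i ->
    \sum_(j < m | j < i) tnth a j * tnth c j < tnth c i.

Definition optimal (m : nat) (c : m.-tuple nat) (x : nat)
    (a : m.-tuple nat) : Prop :=
  representation c x a /\
  forall b : m.-tuple nat, representation c x b -> rep_size a <= rep_size b.

Definition canonical (m : nat) (c : m.-tuple nat) : Prop :=
  forall (x : nat) (a b : m.-tuple nat),
    greedy c x a -> optimal c x b -> rep_size a = rep_size b.

Definition counterexample (m : nat) (c : m.-tuple nat) (x : nat) : Prop :=
  exists a b : m.-tuple nat,
    [/\ greedy c x a, optimal c x b & rep_size b < rep_size a].

Lemma coin_gt0 (m : nat) (c : m.-tuple nat) (i : 'I_m) :
  coin_system c -> 0 < tnth c i.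
Proof.
case=> c0 sc; rewrite (tnth_nth 0).
case: (posnP i) => [->|i0]; first by rewrite c0.
have m0 : 0 < m by apply: leq_ltn_trans (ltn_ord i).
have := sorted_ltn_nth ltn_trans 0 sc.
by move/(_ 0 i); rewrite !inE size_tuple m0 ltn_ord => /(_ isT isT i0); apply: leq_trans.
Qed.

Lemma greedy_exists (m : nat) (c : m.-tuple nat) (x : nat) :
  coin_system c -> exists a, greedy c x a.
Proof.
move=> sc; have cgt := coin_gt0 _ sc; case: (sc) => c0 _.
have m0 : 0 < m by case: (posnP m) c0 => // m0; rewrite nth_default // size_tuple m0.
have H n : 0 < n <= m -> forall y, exists f : nat -> nat,
    \sum_(0 <= j < n) f j * nth 0 c j = y /\
    forall i, 0 < i < n -> \sum_(0 <= j < i) f j * nth 0 c j < nth 0 c i.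
  elim: n => // n IHn /= ltnm y; case: (posnP n) => [->|n0].
    exists (fun=> y); rewrite big_nat1 c0 muln1; split=> // i.
    by case: i.
  have cn0 : 0 < nth 0 c n by have := cgt (Ordinal ltnm); rewrite (tnth_nth 0).
  have [|f [fy fg]] := IHn _ (y %% nth 0 c n); first by rewrite n0 ltnW.
  pose g j := if j < n then f j else y %/ nth 0 c n.
  have gE i : i <= n ->
      \sum_(0 <= j < i) g j * nth 0 c j = \sum_(0 <= j < i) f j * nth 0 c j.
    move=> lein; apply: eq_big_nat => j /andP[_ ltji].
    by rewrite /g (leq_trans ltji lein).
  exists g; split=> [|i /andP[i0]].
    by rewrite big_nat_recr //= gE // fy /g ltnn addnC -divn_eq.
  rewrite ltnS => lein; rewrite gE //.
  case: (ltngtP i n) lein => // [ltin _|-> _]; first by rewrite fg // i0.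
  by rewrite fy ltn_mod.
have [|f [fx fg]] := H m _ x; first by rewrite m0 leqnn.
exists [tuple f i | i < m]; split.
  rewrite /representation -fx big_mkord; apply: eq_bigr => i _.
  by rewrite tnth_mktuple (tnth_nth 0).
move=> i i0; rewrite (tnth_nth 0); have /(_ _)/(leq_ltn_trans _) := fg i.
rewrite i0 ltn_ord => -> //; rewrite big_mkord (big_ord_widen m (fun j => f j * nth 0 c j)) ?(ltnW (ltn_ord i)) //.
by apply: eq_leq; apply: eq_bigr => j _; rewrite tnth_mktuple (tnth_nth 0).
Qed.

Lemma greedy_unique (m : nat) (c : m.-tuple nat) (x : nat)
    (a b : m.-tuple nat) :
  coin_system c -> greedy c x a -> greedy c x b -> a = b.
Proof.
move=> sc [ax ag] [bx bg]; have cgt := coin_gt0 _ sc; case: (sc) => c0 _.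
pose S (t : m.-tuple nat) n := \sum_(j < m | j < n) tnth t j * tnth c j.
have SS t (i : 'I_m) : S t i.+1 = tnth t i * tnth c i + S t i.
  rewrite /S (bigD1 i) //=; congr (_ + _).
  by apply: eq_bigl => j; rewrite ltnS [RHS]ltn_neqAle andbC.
have S0 t : S t 0 = 0 by rewrite /S big_pred0.
have Sm t : S t m = \sum_(j < m) tnth t j * tnth c j.
  by apply: eq_bigl => j; rewrite ltn_ord.
have key n : n <= m -> S a n = S b n -> forall i : 'I_m, i < n -> tnth a i = tnth b i.
  elim: n => // n IHn ltnm; pose k := Ordinal ltnm.
  rewrite (SS a k) (SS b k) => eqS.
  have [eqk eqn] : tnth a k = tnth b k /\ S a n = S b n.
    case: (posnP n) => [n0|n0].
      move: eqS; rewrite /= n0 !S0 !addn0 => /eqP.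
      by rewrite eqn_pmul2r // => /eqP.
    have la := ag k n0; have lb := bg k n0.
    have eqk : tnth a k = tnth b k.
      have := congr1 (divn^~ (tnth c k)) eqS.
      by rewrite !divnMDl // !divn_small // !addn0.
    by split=> //; move: eqS; rewrite eqk => /addnI.
  move=> i; rewrite ltnS leq_eqVlt => /orP[/eqP ik|]; last by apply: IHn (ltnW ltnm) eqn _.
  by have -> : i = k by apply: val_inj.
apply: eq_from_tnth => i; apply: (key m) (ltn_ord i) => //.
by rewrite !Sm ax bx.
Qed.

Lemma optimal_exists (m : nat) (c : m.-tuple nat) (x : nat) :
  coin_system c -> exists a, optimal c x a.
Proof.
move=> sc; have cgt := coin_gt0 _ sc.
pose emb (t : m.-tuple 'I_x.+1) : m.-tuple nat := map_tuple val t.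
pose P t := \sum_(i < m) tnth (emb t) i * tnth c i == x.
have embP b : representation c x b -> exists2 t, P t & emb t = b.
  move=> bx; have le i : tnth b i < x.+1.
    rewrite ltnS -bx (bigD1 i) //= (leq_trans _ (leq_addr _ _)) //.
    exact: leq_pmulr.
  exists [tuple Ordinal (le i) | i < m]; last first.
    by apply: eq_from_tnth => i; rewrite tnth_map tnth_mktuple.
  apply/eqP; rewrite -[RHS]bx; apply: eq_bigr => i _.
  by rewrite tnth_map tnth_mktuple.
have [a [ax _]] := greedy_exists x sc.
have [t0 Pt0 _] := embP a ax.
case: (arg_minnP (fun t => rep_size (emb t)) Pt0) => t /eqP Pt tmin.
by exists (emb t); split=> // b /embP[u Pu <-]; apply: tmin.
Qed.

Lemma optimal_size_unique (m : nat) (c : m.-tuple nat) (x : nat)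
    (a b : m.-tuple nat) :
  optimal c x a -> optimal c x b -> rep_size a = rep_size b.
Proof.
move=> [ra am] [rb bm]; apply/eqP.
by rewrite eqn_leq am // bm.
Qed.

(* Main.v *)
(* Write p = c_2, q = c_3 and q + d = (k + 1) p with d < p.  An exchange
   argument shows that <1, p, q> is canonical when d <= k, so here k < d.
   Let c_i, i >= 3, be the last coin such that i = 3 or c_i - c_(i-1) < q - 1.
   For y < q - 1 the number c_i + y lies below c_(i+1), so its greedy
   representation is c_i followed by the one of y over <1, p>.  It is beaten
   - if i = 3, for y = d, by k + 1 coins p;
   - if c_i - c_(i-1) = 1, for y = p - 1, by c_(i-1) + p;
   - if c_i - c_(i-1) = q - p, for y = d, by c_(i-1) and k coins p;
   - otherwise, for y = q - (c_i - c_(i-1)), by c_(i-1) + q. *)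
Require Import Defs.
From mathcomp Require Import all_boot.
From mathcomp Require Import zify.

Set Implicit Arguments.
Unset Strict Implicit.
Unset Printing Implicit Defensive.

Lemma coin_ltn (m : nat) (c : m.-tuple nat) (i j : nat) :
  coin_system c -> i < j < m -> nth 0 c i < nth 0 c j.
Proof.
case=> _ sc /andP[lt_ij lt_jm].
apply: (sorted_ltn_nth ltn_trans 0 sc) => //; rewrite inE size_tuple //.
exact: ltn_trans lt_ij lt_jm.
Qed.

Lemma counterexample_of_smaller (m : nat) (c a b : m.-tuple nat) (x : nat) :
    coin_system c -> greedy c x a -> representation c x b ->
  rep_size b < rep_size a -> counterexample c x.
Proof.
move=> sc ga rb ltba; have [o [ro omin]] := optimal_exists x sc.
by exists a, o; split=> //; apply: leq_ltn_trans (omin b rb) ltba.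
Qed.

Lemma counterexample_not_canonical (m : nat) (c : m.-tuple nat) (x : nat) :
  counterexample c x -> ~ canonical c.
Proof. by case=> a [b [ga ob]] /[swap] /(_ x a b ga ob) ->; rewrite ltnn. Qed.

(** Lists of coin indices stand for representations: concrete ones are written coin by coin, and
    their size is the length of the list. *)
Definition tally_tuple (m : nat) (s : seq 'I_m) : m.-tuple nat :=
  [tuple count_mem i s | i < m].

Lemma sum_tally_tuple (m : nat) (s : seq 'I_m) (P : pred 'I_m) (F : 'I_m -> nat) :
  \sum_(i < m | P i) tnth (tally_tuple s) i * F i = \sum_(i <- s | P i) F i.
Proof.
elim: s => [|j s IHs].
  by rewrite big_nil big1 // => i _; rewrite tnth_mktuple.
rewrite big_cons -IHs.
have -> : \sum_(i < m | P i) tnth (tally_tuple (j :: s)) i * F i =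
    \sum_(i < m | P i) (j == i) * F i +
    \sum_(i < m | P i) tnth (tally_tuple s) i * F i.
  by rewrite -big_split; apply: eq_bigr => i _; rewrite !tnth_mktuple /= mulnDl.
case Pj: (P j); last first.
  by rewrite big1 // => i Pi; case: eqP => // ji; rewrite ji Pi in Pj.
rewrite (bigD1 j) //= eqxx mul1n big1 ?addn0 // => i /andP[_ /negPf].
by rewrite eq_sym => ->.
Qed.

Lemma rep_size_tally_tuple (m : nat) (s : seq 'I_m) :
  rep_size (tally_tuple s) = size s.
Proof.
rewrite -sum1_size -sum_tally_tuple /rep_size.
by apply: eq_bigr => i _; rewrite muln1.
Qed.

Lemma representation_tally_tuple (m : nat) (c : m.-tuple nat) (s : seq 'I_m) :
  representation c (\sum_(i <- s) tnth c i) (tally_tuple s).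
Proof. exact: sum_tally_tuple. Qed.

(** Three exchanges lower the number of coins below [q] without raising the size: [p] coins 1 become
    one [p]; [k.+1] coins [p] become one [q] and [d] coins 1; if [a0] coins 1 and [k] coins [p]
    reach [q], they become one [q] and [a0 + d - p] coins 1. *)
Lemma exchange3 (p q k d : nat) :
    1 < p -> q + d = k.+1 * p -> d < p -> d <= k ->
  forall a0 a1 a2 : nat, exists g0 g1 g2 : nat,
    [/\ g0 < p, g0 + g1 * p < q,
        g0 + g1 * p + g2 * q = a0 + a1 * p + a2 * q
      & g0 + g1 + g2 <= a0 + a1 + a2].
Proof.
move=> p_gt1 qd ltdp ledk a0 a1.
have [n] := ubnP (a0 + a1); elim: n a0 a1 => // n IHn a0 a1 lean a2.
have [ltap|lepa] := ltnP a0 p; last first.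
  have [|g0 [g1 [g2 [? ? ? ?]]]] := IHn (a0 - p) a1.+1 _ a2; first by lia.
  by exists g0, g1, g2; split=> //; nia.
have [lea1k|lt_ka1] := leqP a1 k; last first.
  have [|g0 [g1 [g2 [? ? ? ?]]]] := IHn (a0 + d) (a1 - k.+1) _ a2.+1.
    by lia.
  exists g0, g1, g2; split=> //; last by lia.
  have -> : a1 = (a1 - k.+1) + k.+1 by lia.
  by rewrite mulnDl; nia.
have [ltaq|leqa] := ltnP (a0 + a1 * p) q; first by exists a0, a1, a2.
have a1k : a1 = k by nia.
have [|g0 [g1 [g2 [? ? ? ?]]]] := IHn (a0 + d - p) 0 _ a2.+1; first by nia.
by exists g0, g1, g2; split=> //; nia.
Qed.

(** Exchanges turn the optimal [b] into a greedy representation that is no larger, and the greedy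
    representation is unique. *)
Lemma canonical3 (p q k d : nat) :
    1 < p < q -> q + d = k.+1 * p -> d < p -> d <= k ->
  canonical [tuple 1; p; q].
Proof.
move=> /andP[p_gt1 ltpq] qd ltdp ledk x a b ga [rb bmin].
have sc : coin_system [tuple 1; p; q] by split; rewrite //= p_gt1 ltpq.
apply/eqP; rewrite eqn_leq (bmin _ (proj1 ga)) andbT.
have [g0 [g1 [g2 [lt1 lt2 eqx le_size]]]] := exchange3 p_gt1 qd ltdp ledk
  (tnth b ord0) (tnth b (lift ord0 ord0)) (tnth b (lift ord0 (lift ord0 ord0))).
have gg : greedy [tuple 1; p; q] x [tuple g0; g1; g2].
  split.
    rewrite -rb /representation !big_ord_recl !big_ord0 /= !(tnth_nth 0) /=.
    by move: eqx; rewrite !(tnth_nth 0) /=; lia.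
  case=> [[|[|[|i]]] lti] // _; rewrite !big_mkcond !big_ord_recl !big_ord0 /=;
    by rewrite !(tnth_nth 0) /=; lia.
rewrite (greedy_unique sc ga gg) /rep_size !big_ord_recl !big_ord0 /=.
by move: le_size; rewrite !(tnth_nth 0) /=; lia.
Qed.

Lemma noncanonical3 (p q : nat) :
    1 < p < q -> ~ canonical [tuple 1; p; q] ->
  exists k d : nat, [/\ q + d = k.+1 * p, d < p & 0 < k < d].
Proof.
move=> ltpq ncan; case/andP: (ltpq) => p_gt1 lt_pq.
(* Thus [k.+1] is the quotient of [q] by [p] rounded up; dividing [q.-1] instead of [q] keeps
   [d < p] when [p] divides [q]. *)
pose k := q.-1 %/ p; pose d := k.+1 * p - q.
have ltmod : q.-1 %% p < p by rewrite ltn_mod; lia.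
have dm : q.-1 = k * p + q.-1 %% p := divn_eq q.-1 p.
have qd : q + d = k.+1 * p by rewrite /d mulSn; lia.
have ltdp : d < p by rewrite /d mulSn; lia.
exists k, d; split=> //; apply/andP; split; first by rewrite /k divn_gt0; lia.
by rewrite ltnNge; apply/negP => ledk; apply: ncan; apply: canonical3 qd _ _.
Qed.

Lemma greedy_above (m : nat) (c : m.-tuple nat) (i0 i1 i : 'I_m) (y : nat) :
    coin_system c -> i0 = 0 :> nat -> i1 = 1 :> nat -> 1 < i ->
    y < nth 0 c 2 -> (i.+1 < m -> nth 0 c i + y < nth 0 c i.+1) ->
  greedy c (nth 0 c i + y)
    (tally_tuple (i :: nseq (y %/ nth 0 c 1) i1 ++ nseq (y %% nth 0 c 1) i0)).
Proof.
move=> sc i00 i11 i_gt1 lty ltnext; set p := nth 0 c 1.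
have lt_im := ltn_ord i; have c0 : nth 0 c 0 = 1 by case: sc.
have p_gt0 : 0 < p by rewrite -c0 ltnW ?(coin_ltn sc) //; lia.
have dm : p * (y %/ p) + y %% p = y by rewrite mulnC -divn_eq.
split=> [|j j_gt0].
  rewrite /representation sum_tally_tuple big_cons big_cat !big_nseq !iter_addn_0.
  by rewrite !(tnth_nth 0) i00 i11 c0 mul1n -/p /= dm.
have lt_jm := ltn_ord j.
rewrite sum_tally_tuple big_cons big_cat !big_nseq_cond !(tnth_nth 0) i00 i11.
rewrite j_gt0 !iter_addn_0 c0 mul1n -/p /=.
(* For [j] above [i] the prefix is the whole sum, bounded by the coin after [i]; for [1 < j <= i] it
   is [y]; for [j = 1] it is the remainder of [y] modulo [p]. *)
have [lt_ij|le_ji] := ltnP i j.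
  have -> : 1 < j by lia.
  rewrite dm; apply: leq_trans (ltnext _) _; first by lia.
  by have [<- //|ne] := eqVneq i.+1 j; rewrite ltnW ?(coin_ltn sc) //; lia.
have [j_gt1|j_le1] := ltnP 1 j.
  rewrite dm; apply: leq_trans lty _.
  by have [<- //|ne] := eqVneq 2 j; rewrite ltnW ?(coin_ltn sc) //; lia.
have -> : j = 1 :> nat by lia.
by rewrite add0n ltn_mod.
Qed.

Lemma last_index (P : pred nat) (n m : nat) :
    n < m -> P n ->
  exists i : nat, [/\ n <= i < m, P i & forall j : nat, i < j < m -> ~~ P j].
Proof.
move=> ltnm Pn; have exP : exists i, (n <= i < m) && P i by exists n; rewrite leqnn ltnm.
have bnd i : (n <= i < m) && P i -> i <= m by case/andP=> /andP[_ /ltnW].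
case: (ex_maxnP exP bnd) => i /andP[lim Pi] imax; exists i; split=> // j lij.
by apply/negP => Pj; have := imax j; rewrite Pj; lia.
Qed.

Theorem theorem8 (m : nat) (c : m.-tuple nat) :
  4 <= m ->
  coin_system c ->
  ~ canonical [tuple 1; nth 0 c 1; nth 0 c 2] ->
  ~ canonical c /\
  exists x : nat, counterexample c x /\ x < nth 0 c m.-1 + nth 0 c 2.
Proof.
move=> m4 sc ncan3.
suff [x [cx ltx]] : exists x, counterexample c x /\ x < nth 0 c m.-1 + nth 0 c 2.
  by split; [apply: counterexample_not_canonical cx | exists x].
have c0 : nth 0 c 0 = 1 by case: sc.
have lt1p : 1 < nth 0 c 1 by rewrite -c0 (coin_ltn sc) //; lia.
have ltpq : nth 0 c 1 < nth 0 c 2 by rewrite (coin_ltn sc) //; lia.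
have [|k [d [qd ltdp /andP[k_gt0 ltkd]]]] := noncanonical3 _ ncan3.
  by rewrite lt1p.
have lt0m : 0 < m by lia.
have lt1m : 1 < m by lia.
have lt2m : 2 < m by lia.
pose i0 := Ordinal lt0m; pose i1 := Ordinal lt1m; pose i2 := Ordinal lt2m.
(* Index 2 is the third coin; admitting it outright guarantees that a last index satisfying [P]
   exists. *)
pose P i := (i == 2) || (nth 0 c i < nth 0 c i.-1 + (nth 0 c 2).-1).
have [//|i [/andP[le2i ltim] Pi imax]] := @last_index P 2 m lt2m.
pose io := Ordinal ltim.
have lei : nth 0 c i <= nth 0 c m.-1.
  have [-> //|ne] := eqVneq i m.-1.
  by rewrite ltnW ?(coin_ltn sc) //; lia.
(* The size bound on [s] omits the leading coin of the greedy representation, so [<=] already yields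
   a strict improvement. *)
have beaten y (s : seq 'I_m) : y < (nth 0 c 2).-1 ->
    \sum_(j <- s) tnth c j = nth 0 c i + y ->
    size s <= y %/ nth 0 c 1 + y %% nth 0 c 1 ->
    exists x, counterexample c x /\ x < nth 0 c m.-1 + nth 0 c 2.
  move=> lty sx les; exists (nth 0 c i + y); split; last by lia.
  have lty2 : y < nth 0 c 2 by lia.
  have ltnext : i.+1 < m -> nth 0 c i + y < nth 0 c i.+1.
    (* Since [i] is the last index satisfying [P], the next gap is at least [q - 1], hence exceeds
       [y]. *)
    move=> lti; have /imax : i < i.+1 < m by rewrite ltnS leqnn.
    by rewrite /P /= negb_or => /andP[_]; rewrite -leqNgt; lia.
  have gx := @greedy_above m c i0 i1 io y sc erefl erefl le2i lty2 ltnext.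
  apply: (counterexample_of_smaller (b := tally_tuple s) sc gx).
    by rewrite -sx; apply: representation_tally_tuple.
  by rewrite !rep_size_tally_tuple /= size_cat !size_nseq ltnS.
have [i_eq2|i_ne2] := eqVneq i 2.
  apply: (beaten d (nseq k.+1 i1)); first by lia.
    by rewrite big_nseq iter_addn_0 (tnth_nth 0) i_eq2 qd mulnC.
  by rewrite size_nseq divn_small // modn_small.
have ltpred : i.-1 < m by lia.
pose io' := Ordinal ltpred.
have ltgap : nth 0 c i.-1 < nth 0 c i by rewrite (coin_ltn sc) //; lia.
have gap_lt : nth 0 c i < nth 0 c i.-1 + (nth 0 c 2).-1.
  by move: Pi; rewrite /P (negPf i_ne2).
have [gap1|gap_ne1] := eqVneq (nth 0 c i) (nth 0 c i.-1).+1.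
  apply: (beaten (nth 0 c 1).-1 [:: io'; i1]); first by lia.
    by rewrite !big_cons big_nil !(tnth_nth 0) /=; lia.
  (* Two coins suffice because [0 < k < d < p] forces [p >= 3]. *)
  by rewrite divn_small ?modn_small //=; lia.
have [gapqp|gap_neqp] :=
    eqVneq (nth 0 c i + nth 0 c 1) (nth 0 c i.-1 + nth 0 c 2).
  apply: (beaten d (io' :: nseq k i1)); first by lia.
    rewrite big_cons big_nseq iter_addn_0 !(tnth_nth 0) /= mulnC.
    by move: qd; rewrite mulSn; lia.
  by rewrite /= size_nseq divn_small // modn_small.
apply: (beaten (nth 0 c i.-1 + nth 0 c 2 - nth 0 c i) [:: io'; i2]); first by lia.
  by rewrite !big_cons big_nil !(tnth_nth 0) /=; lia.
(* The gap is below [q - 1] and differs from [q - p], so [y > 1] and [y] is not [p]; hence its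
   quotient and remainder by [p] add up to at least 2. *)
set y := _ - _; have y_gt1 : 1 < y by lia.
have := divn_eq y (nth 0 c 1); have y_nep : y != nth 0 c 1 by lia.
by case: (y %/ _) => [|[|n]] /=; lia.
Qed.
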